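(* Let $X$ be a connected topological space with exactly two path components, each of them simply connected and locally path-connected, and let $x_0,x_1\in X$ be points from different path components of $X$. Let $X_2=X\cup A\cup B$ be obtained from $X$ by adding two bridges $A$ and $B$, each joining $x_0$ and $x_1$. Let $\tilde X_2$ be obtained from $X\times\{0,1\}$ by adding four bridges: $A_0$ joining $(x_0,0)$ and $(x_1,1)$, $A_1$ joining $(x_0,1)$ and $(x_1,0)$, $B_0$ joining $(x_0,0)$ and $(x_1,0)$, and $B_1$ joining $(x_0,1)$ and $(x_1,1)$. Let $p_1:\tilde X_2\to X_2$ be the two-fold covering map that extends the projection $X\times\{0,1\}\to X$ and sends each of $A_0,A_1$ homeomorphically onto $A$ and each of $B_0,B_1$ homeomorphically onto $B$. Let $p_2:\tilde X_2\to X_2$ be the two-fold covering map that extends the projection $X\times\{0,1\}\to X$ and sends each of $A_0,A_1$ homeomorphically onto $B$ and each of $B_0,B_1$ homeomorphically onto $A$. Then there is no continuous map $f:\tilde X_2\to\tilde X_2$ such that $p_i\circ f=p_j$ for $i\neq j$, $1\le i,j\le 2$; that is, neither $p_1\circ f=p_2$ nor $p_2\circ f=p_1$ holds for any continuous $f:\tilde X_2\to\tilde X_2$.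
   Context: Adding a bridge joining points $a\neq b$ of a space $Y$ means attaching an arc (a copy of $[0,1]$) to $Y$ by identifying its endpoints with $a$ and $b$ respectively, the interior of the arc being disjoint from $Y$; the result carries the quotient (adjunction) topology. Different bridges have pairwise disjoint interiors. The set $\{0,1\}$ is discrete. When a bridge of $\tilde X_2$ is sent homeomorphically onto a bridge of $X_2$, endpoints are mapped as dictated by the projection $X\times\{0,1\}\to X$: an endpoint $(x_k,\epsilon)$ goes to $x_k$. A space is simply connected if it is path-connected with trivial fundamental group. *)

(* Defs.v *)
From HB Require Import structures.
From Stdlib Require Import Relation_Operators.
From mathcomp Require Import all_boot all_order all_algebra.
From mathcomp Require Import all_classical all_reals.
From mathcomp Require Import topology continuous_path.

Import Order.TTheory GRing.Theory Num.Theory.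
Import numFieldTopology.Exports.

Set Implicit Arguments.
Unset Strict Implicit.
Unset Printing Implicit Defensive.

Local Open Scope classical_set_scope.
Local Open Scope ring_scope.

Definition unit_itv (R : realType) : Type := set_type (`[0, 1]%classic : set R).

HB.instance Definition _ (R : realType) :=
  Topological.copy (unit_itv R) (set_type (`[0, 1]%classic : set R)).

Section UnitInterval.
Variable R : realType.

Lemma mem0_unit_itv : (0 : R) \in `[0, 1]%classic.
Proof. by rewrite inE /= in_itv /= lexx ler01. Qed.

Lemma mem1_unit_itv : (1 : R) \in `[0, 1]%classic.
Proof. by rewrite inE /= in_itv /= lexx ler01. Qed.

Definition itv0 : unit_itv R := exist _ 0 mem0_unit_itv.
Definition itv1 : unit_itv R := exist _ 1 mem1_unit_itv.

Lemma itv0_neq1 : itv0 != itv1.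
Proof. by apply/eqP => /(congr1 val) /= /esym/eqP; rewrite oner_eq0. Qed.

HB.instance Definition _ := isBiPointed.Build (unit_itv R) itv0_neq1.

End UnitInterval.

Section PathNotions.
Variable R : realType.
Implicit Types T : topologicalType.

Definition path_component T (x : T) : set T :=
  [set y | inhabited {path (unit_itv R) from x to y}].

Definition path_connected T := forall x y : T, path_component x y.

Definition path_homotopic T (x y : T)
    (p q : {path (unit_itv R) from x to y}) : Prop :=
  exists H : unit_itv R * unit_itv R -> T, [/\ continuous H,
    forall s, H (s, zero) = p s,
    forall s, H (s, one) = q s,
    forall t, H (zero, t) = x &
    forall t, H (one, t) = y].

Definition homotopy_class T (x : T) (p : {path (unit_itv R) from x to x}) :
    set {path (unit_itv R) from x to x} := [set q | path_homotopic p q].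

(* The underlying set of the fundamental group based at x. *)
Definition pi1 T (x : T) : set (set {path (unit_itv R) from x to x}) :=
  range (@homotopy_class T x).

Definition pi1_unit T (x : T) : set {path (unit_itv R) from x to x} :=
  homotopy_class (cst x : {path (unit_itv R) from x to x}).

Arguments pi1 {T} x.
Arguments pi1_unit {T} x.

Definition simply_connected T :=
  path_connected T /\ forall x : T, pi1 x = [set pi1_unit x].

Definition locally_path_connected T :=
  forall (x : T) (U : set T), nbhs x U ->
    exists V : set T, [/\ open_nbhs x V, V `<=` U & path_connected (set_type V)].

End PathNotions.

(* Maps between subsets; both carry the subspace topology. *)
Definition homeo_onto (T U : topologicalType) (f : T -> U)
    (S : set T) (S' : set U) : Prop :=
  [/\ {within S, continuous f}, set_bij S S' f &
    exists2 g : U -> T, {within S', continuous g} & {in S, cancel f g}].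

Definition two_fold_covering (E B : topologicalType) (p : E -> B) : Prop :=
  continuous p /\
  forall y : B, exists (V : set B) (U : bool -> set E),
    [/\ open_nbhs y V, forall i, open (U i), U false `&` U true = set0,
        p @^-1` V = U false `|` U true &
        forall i, homeo_onto p (U i) V].

(* The space obtained from Y by adding, for each j : J, a bridge joining      *)
(* a j and b j.                                                               *)
Section Bridges.
Variables (R : realType) (Y : topologicalType) (J : choiceType) (a b : J -> Y).

Definition bridge_piece (i : option J) : topologicalType :=
  if i is Some _ then unit_itv R else Y.

Definition bridge_sum : Type := {i : option J & bridge_piece i}.
HB.instance Definition _ := Topological.on bridge_sum.

Definition sum_base (y : Y) : bridge_sum := existT bridge_piece None y.
Definition sum_arc (j : J) (t : unit_itv R) : bridge_sum :=
  existT bridge_piece (Some j) t.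

Variant bridge_glue : bridge_sum -> bridge_sum -> Prop :=
| glue_zero j : bridge_glue (sum_arc j zero) (sum_base (a j))
| glue_one j : bridge_glue (sum_arc j one) (sum_base (b j)).

Definition bridge_rel (u v : bridge_sum) : bool :=
  `[< clos_refl_sym_trans _ bridge_glue u v >].

Lemma bridge_rel_refl : reflexive bridge_rel.
Proof. by move=> u; apply/asboolP; exact: rst_refl. Qed.

Lemma bridge_rel_sym : symmetric bridge_rel.
Proof.
by move=> u v; apply/asboolP/asboolP => uv; apply: rst_sym.
Qed.

Lemma bridge_rel_trans : transitive bridge_rel.
Proof.
move=> v u w /asboolP uv /asboolP vw; apply/asboolP.
exact: rst_trans uv vw.
Qed.

Definition bridge_equiv :=
  EquivRel _ bridge_rel_refl bridge_rel_sym bridge_rel_trans.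

Local Open Scope quotient_scope.

Definition add_bridges : Type := {eq_quot bridge_equiv}.
HB.instance Definition _ :=
  Topological.copy add_bridges (quotient_topology {eq_quot bridge_equiv}).
HB.instance Definition _ := Quotient.on add_bridges.

Definition base_pt (y : Y) : add_bridges := \pi_add_bridges (sum_base y).

Definition arc (j : J) : set add_bridges :=
  range (fun t => \pi_add_bridges (sum_arc j t) : add_bridges).

End Bridges.

Arguments base_pt R {Y J} a b y.
Arguments arc R {Y J} a b j.

Variant letter := brA | brB.

Definition letter_code (l : letter) : bool := if l is brB then true else false.
Definition letter_decode (c : bool) : letter := if c then brB else brA.
Lemma letter_codeK : cancel letter_code letter_decode.
Proof. by case. Qed.
HB.instance Definition _ := Choice.copy letter (can_type letter_codeK).

Definition swap_letter (l : letter) : letter := if l is brA then brB else brA.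

Section TwoSpaces.
Variables (R : realType) (X : topologicalType) (x0 x1 : X).

Definition X2 : Type := @add_bridges R X letter (fun=> x0) (fun=> x1).
HB.instance Definition _ := Topological.on X2.

(* In X * {0, 1} and in the bridge indices, 0 is false and 1 is true; the     *)
(* bridge l_i is indexed by (l, i).                                           *)
Definition tX2_start (j : letter * bool) : (X * bool)%type := (x0, j.2).
Definition tX2_end (j : letter * bool) : (X * bool)%type :=
  (x1, if j.1 is brA then ~~ j.2 else j.2).

Definition tX2 : Type :=
  @add_bridges R (X * bool)%type (letter * bool)%type tX2_start tX2_end.
HB.instance Definition _ := Topological.on tX2.

(* p extends the projection and maps the bridge l_i onto the bridge s l.      *)
Definition bridge_covering (s : letter -> letter) (p : tX2 -> X2) : Prop :=
  [/\ two_fold_covering p,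
      forall x e, p (base_pt R tX2_start tX2_end (x, e)) =
                  base_pt R (fun=> x0) (fun=> x1) x &
      forall l i, homeo_onto p (arc R tX2_start tX2_end (l, i))
                               (arc R (fun=> x0) (fun=> x1) (s l))].

End TwoSpaces.

(* Main.v *)
(* Lifts through a two-fold covering are determined on a connected domain by
   one value. Suppose [p \o f = q], where [q] sends [B_0] to the bridge that is
   the image of [A_0] and [A_1] under [p]. As [X] is connected, uniqueness of
   lifts makes [f] map [X * {0}] to a single sheet [X * {e}]. Then [f]
   restricted to [B_0] lifts a path in that bridge starting from [(x0, e)], hence agrees
   with the lift inside [A_e], whose other end is [(x1, 1 - e)]; but [f] sends
   the end of [B_0] to [(x1, e)]. *)

Require Import Defs.
From mathcomp Require Import all_boot all_order all_algebra.
From mathcomp Require Import all_classical all_reals.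
From mathcomp Require Import topology.
From mathcomp Require Import normed_module.
From Stdlib Require Import Relation_Operators.

Local Open Scope classical_set_scope.

(** A clopen [B] of the subtype is the trace of an open [V], and its complement is the trace of an
    open [W]; then [V] and the closed set complementary to [W] cut out the same part of [A], to
    which connectedness of [A] applies. *)
Lemma connected_set_type {T : topologicalType} {A : set T} :
  connected A -> connected [set: set_type A].
Proof.
move=> A_conn B [b Bb] [C C_open]; rewrite setTI => BC.
move=> [D D_closed]; rewrite setTI => BD; subst C D.
have [V V_open VB] := C_open.
have [W W_open WB] : open (~` B) by exact: closed_openC.
have VP x : V (val x) <-> B x by rewrite -VB.
have WP x : W (val x) <-> ~ B x by rewrite -[~ B x]/((~` B) x) -WB.
have AV : A `&` V = A.
  apply: A_conn.
  - by exists (val b); split; [exact: set_valP | exact/VP].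
  - by exists V.
  - exists (~` W); first exact: open_closedC.
    apply/seteqP; split=> x [Ax Vx]; split=> //.
      move=> Wx; have /= := WP (exist _ x (mem_set Ax)).
      by move=> [/(_ Wx)] + _; apply; apply/VP.
    have := VP (exist _ x (mem_set Ax)) => /= ->.
    apply: contrapT => nB; apply: Vx.
    by have /= [_] := WP (exist _ x (mem_set Ax)); apply.
apply/seteqP; split=> // x _; apply/VP.
by have [] : (A `&` V) (val x) by rewrite AV; exact: set_valP.
Qed.

Lemma connected_unit_itv (R : realType) : connected [set: unit_itv R].
Proof. exact: (connected_set_type (@segment_connected R 0%R 1%R)). Qed.

Lemma within_continuous_comp {S T U : topologicalType} {A : set T} {u : S -> T}
    {g : T -> U} :
  continuous u -> (forall s, A (u s)) -> {within A, continuous g} ->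
  continuous (g \o u).
Proof.
move=> u_cont uA /subspace_continuousP g_cont s N /(g_cont _ (uA s)) gN.
(* Continuity within [A] controls [g] only at points of [A], and [u] takes all its values there. *)
apply: (@filterS _ _ _ (u @^-1` [set y | A y -> N (g y)])).
  by move=> r; apply; exact: uA.
exact: (u_cont s _ gN).
Qed.

(** The set where [u] and [v] agree is clopen. Over an evenly covered neighbourhood, equal values
    lie in a common sheet, on which [p] is injective, so agreement persists nearby; distinct values
    lie in different sheets, which are open and disjoint, so disagreement persists too. *)
Lemma two_fold_covering_unique_lift {T E B : topologicalType} {p : E -> B}
    {u v : T -> E} {t : T} :
  connected [set: T] -> two_fold_covering p -> continuous u -> continuous v ->
  p \o u =1 p \o v -> u t = v t -> u =1 v.
Proof.
move=> T_conn [_ p_sheets] u_cont v_cont puv uvt.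
have sheetP s : exists (U : bool -> set E),
    [/\ forall i, open (U i), U false `&` U true = set0,
        exists i, U i (u s), exists i, U i (v s) &
        forall i, {in U i &, injective p}].
  have [V [U [[_ Vy] U_open U0 pVU U_homeo]]] := p_sheets (p (u s)).
  have sheet w : p w = p (u s) -> exists i, U i w.
    move=> pw; have : (p @^-1` V) w by rewrite /= pw.
    by rewrite pVU => -[]; [exists false | exists true].
  exists U; split=> //.
  - exact: sheet.
  - by apply: sheet; rewrite -[LHS]/((p \o v) s) -puv.
  - by move=> i; have [_ []] := U_homeo i.
pose S := [set s | u s = v s].
suff : S = setT by move=> ST s; have : setT s by []; rewrite -ST.
apply: T_conn; first by exists t.
- exists S; last by rewrite setTI.
  rewrite openE => s /= uvs; have [U [U_open _ [i Ui] _ U_inj]] := sheetP s.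
  have nu : nbhs s (u @^-1` U i) by apply/u_cont/open_nbhs_nbhs.
  have nv : nbhs s (v @^-1` U i).
    by apply/v_cont/open_nbhs_nbhs; split; rewrite -?uvs.
  apply: filterS2 nu nv => r ur vr; apply: (U_inj i); rewrite ?inE //.
  exact: puv.
- exists S; last by rewrite setTI.
  rewrite -[S]setCK; apply: open_closedC; rewrite openE => s /= uvs.
  have [U [U_open U0 [i Ui] [j Uj] U_inj]] := sheetP s.
  have nij : i <> j.
    move=> ij; subst j; apply: uvs; apply: (U_inj i); rewrite ?inE //.
    exact: puv.
  have nu : nbhs s (u @^-1` U i) by apply/u_cont/open_nbhs_nbhs.
  have nv : nbhs s (v @^-1` U j) by apply/v_cont/open_nbhs_nbhs.
  apply: filterS2 nu nv => r /= ur vr uvr; rewrite -uvr in vr.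
  suff : (U false `&` U true) (u r) by rewrite U0.
  by clear Ui Uj; case: i j nij ur vr => -[].
Qed.

Section Bridges.
Context {R : realType} {Y : topologicalType} {J : choiceType} {a b : J -> Y}.

Local Notation base := (base_pt R a b).

Definition arc_pt (j : J) (t : unit_itv R) : add_bridges R a b :=
  (\pi_(add_bridges R a b) (sum_arc Y j t))%qT.

Lemma base_pt_continuous : continuous base.
Proof.
move=> y; apply: (@continuous_comp _ _ _ (@sum_base R Y J)
  (\pi_(add_bridges R a b))%qT).
  exact: existT_continuous.
exact: pi_continuous.
Qed.

Lemma arc_pt_continuous (j : J) : continuous (arc_pt j).
Proof.
move=> y; apply: (@continuous_comp _ _ _ (@sum_arc R Y J j)
  (\pi_(add_bridges R a b))%qT).
  exact: (@existT_continuous _ (@bridge_piece R Y J) (Some j)).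
exact: pi_continuous.
Qed.

Lemma bridge_glue_eq (u v : bridge_sum R Y J) : bridge_glue a b u v ->
  (\pi_(add_bridges R a b) u = \pi_(add_bridges R a b) v)%qT.
Proof. by move=> uv; apply/eqquotP/asboolP; exact: rst_step. Qed.

Lemma arc_pt0 (j : J) : arc_pt j zero = base (a j).
Proof. by apply: bridge_glue_eq; exact: glue_zero. Qed.

Lemma arc_pt1 (j : J) : arc_pt j one = base (b j).
Proof. by apply: bridge_glue_eq; exact: glue_one. Qed.

Lemma arc_start (j : J) : Defs.arc R a b j (base (a j)).
Proof. by exists zero => //; exact: arc_pt0. Qed.

Lemma arc_end (j : J) : Defs.arc R a b j (base (b j)).
Proof. by exists one => //; exact: arc_pt1. Qed.

Lemma add_bridges_cases (z : add_bridges R a b) :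
  (exists y, z = base y) \/ exists j, Defs.arc R a b j z.
Proof.
elim/quotW: z => -[[j|] t]; last by left; exists t.
by right; exists j, t.
Qed.

(* The partial retraction onto [Y], defined only on [Y] and the bridge
   endpoints, is compatible with the gluing. *)
Lemma base_pt_inj : injective base.
Proof.
pose r (u : bridge_sum R Y J) : option Y :=
  match u with
  | existT None y => Some y
  | existT (Some j) t =>
      if t == zero then Some (a j) else if t == one then Some (b j) else None
  end.
have r_glue u v : clos_refl_sym_trans _ (bridge_glue a b) u v -> r u = r v.
  elim=> // [_ _ [] j /=|u1 u2 u3 _ -> _ ->] //; first by rewrite eqxx.
  by rewrite eq_sym (negbTE zero_one_neq) eqxx.
by move=> x y /eqquotP/asboolP/r_glue[].
Qed.

End Bridges.

Arguments arc_pt {R Y J} a b j t.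

Section TwoSpaces.
Context {R : realType} {X : topologicalType} {x0 x1 : X}.

Local Notation dn := (base_pt R (fun=> x0) (fun=> x1)).
Local Notation up := (base_pt R (tX2_start x0) (tX2_end x1)).

(** On the base, injectivity of [base_pt] decides. On a closed bridge, [p] is injective and its
    start already lies over [x0]. *)
Lemma bridge_covering_fiber {s : letter -> letter}
    {p : tX2 R x0 x1 -> X2 R x0 x1} {z : tX2 R x0 x1} :
  bridge_covering s p -> p z = dn x0 -> exists e, z = up (x0, e).
Proof.
move=> [_ p_base p_arc] pz.
have [[[x e] zE]|[[l i] zl]] := add_bridges_cases z.
  by move: pz; rewrite zE p_base => /base_pt_inj ->; exists e.
have [_ [_ p_inj _] _] := p_arc l i.
exists i; apply: p_inj; rewrite ?inE ?p_base //.
exact: arc_start.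
Qed.

(** Abstract [s] and [s'] let one argument serve both orders of the two coverings: [id] and
    [swap_letter] satisfy [s brA = s' brB] either way round. *)
Lemma bridge_covering_no_lift {s s' : letter -> letter}
    {p q : tX2 R x0 x1 -> X2 R x0 x1} {f : tX2 R x0 x1 -> tX2 R x0 x1} :
  connected [set: X] -> s brA = s' brB ->
  bridge_covering s p -> bridge_covering s' q ->
  continuous f -> p \o f <> q.
Proof.
move=> X_connected ss' p_cov q_cov f_cont pfq.
have pf z : p (f z) = q z by rewrite -pfq.
have [p_two p_base p_arc] := p_cov; have [[q_cont _] q_base q_arc] := q_cov.
have [e fx0] : exists e, f (up (x0, false)) = up (x0, e).
  by apply: (bridge_covering_fiber p_cov); rewrite pf q_base.
have up_cont i : continuous (fun x => up (x, i)).
  move=> x; apply: (@continuous_comp _ _ _ (fun x => (x, i)) up).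
    apply: (@cvg_pair _ _ _ (nbhs x) (nbhs x) (nbhs i) _ _ _ id (fun=> i)) =>
      //.
    exact: cvg_cst.
  exact: (base_pt_continuous (x, i)).
(* Both sides lift the inclusion [dn] of [X] through [p] and agree at [x0]. *)
have f_base : (fun x => f (up (x, false))) =1 (fun x => up (x, e)).
  apply: (two_fold_covering_unique_lift X_connected p_two) fx0 => //.
    move=> x; apply: (@continuous_comp _ _ _ (fun x => up (x, false)) f).
      exact: up_cont.
    exact: f_cont.
  by move=> x /=; rewrite pf q_base p_base.
have [_ [_ _ p_surj] [g g_cont pK]] := p_arc brA e.
have [_ [q_img _ _] _] := q_arc brB false.
pose u t := q (arc_pt (tX2_start x0) (tX2_end x1) (brB, false) t).
have u_arc t : Defs.arc R (fun=> x0) (fun=> x1) (s brA) (u t).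
  by rewrite ss'; apply: q_img; exists t.
have u_cont : continuous u.
  move=> t; apply: (@continuous_comp _ _ _ (arc_pt _ _ _) q).
    exact: arc_pt_continuous.
  exact: q_cont.
have gu_cont : continuous (g \o u).
  exact: within_continuous_comp g_cont.
pose v t := f (arc_pt (tX2_start x0) (tX2_end x1) (brB, false) t).
have v_cont : continuous v.
  move=> t; apply: (@continuous_comp _ _ _ (arc_pt _ _ _) f).
    exact: arc_pt_continuous.
  exact: f_cont.
have g_dn z : Defs.arc R (tX2_start x0) (tX2_end x1) (brA, e) z -> g (p z) = z.
  by move=> zA; apply: pK; rewrite inE.
(* Two lifts of [u] through [p], both starting at [up (x0, e)]. *)
have vgu : v =1 g \o u.
  apply: (two_fold_covering_unique_lift (connected_unit_itv R) p_two)
    (_ : v zero = _) => //.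
    move=> t; rewrite /= pf -/(u t).
    by have [z zA <-] := p_surj _ (u_arc t); rewrite g_dn.
  rewrite /v /= /u !arc_pt0 fx0 q_base -(p_base x0 e) g_dn //.
  exact: arc_start.
(* At the far end, [v] gives [up (x1, e)], while [A_e] ends at [up (x1, ~~ e)]; injectivity of
   [base_pt] would force [e = ~~ e]. *)
have := vgu one.
rewrite /v /= /u !arc_pt1 f_base q_base -(p_base x1 (~~ e)) g_dn.
  by move=> /base_pt_inj[]; case: e {fx0 f_base p_surj g_cont pK g_dn}.
exact: arc_end.
Qed.

End TwoSpaces.

Theorem proposition2p7 (R : realType) (X : topologicalType) (x0 x1 : X)
  (X_connected : connected [set: X])
  (X_two_path_components : (range (@path_component R X) #= `I_2)%card)
  (X_path_components : forall C : set X, range (@path_component R X) C ->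
    simply_connected R (set_type C) /\ locally_path_connected R (set_type C))
  (x0x1 : path_component R x0 <> path_component R x1)
  (p1 p2 : tX2 R x0 x1 -> X2 R x0 x1)
  (p1_covering : bridge_covering id p1)
  (p2_covering : bridge_covering swap_letter p2) :
  forall f : tX2 R x0 x1 -> tX2 R x0 x1, continuous f ->
    p1 \o f <> p2 /\ p2 \o f <> p1.
Proof.
move=> f f_cont; split.
- exact: (bridge_covering_no_lift X_connected _ p1_covering p2_covering).
- exact: (bridge_covering_no_lift X_connected _ p2_covering p1_covering).
Qed.
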